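(* Let $d\ge2$, $s\in\{2,3,\dots\}$ and $n\in\mathbb N_0$. Let $\mathcal U_n^d(\mathsf w_{-1,-s})$ be the linear span of $$\mathcal H_n^{d,0}\ \cup\ \bigcup_{j=1}^{\min(s-1,n)}P_j^{(2n-2j+d-2,-s)}(1-2t)\,\mathcal H_{n-j}^{d,0}\ \cup\ (1-t)^s\,\mathcal V_{n-s}^d(\mathsf w_{-1,s})$$ (the last set being $\{0\}$ if $n<s$). Then every $Z\in\mathcal U_n^d(\mathsf w_{-1,-s})$ satisfies $\mathcal D_{-s}Z=\lambda_n^{(-s)}Z$ with $\lambda_n^{(-s)}=-n(n-s+d-1)$.
   Context: Cone points $(x,t)=(t\xi,t)$, $\xi\in\mathbb S^{d-1}$. $\mathcal D_\gamma=t(1-t)\frac{\partial^2}{\partial t^2}+\big(d-1-(d+\gamma)t\big)\frac{\partial}{\partial t}+t^{-1}\Delta_0^{(\xi)}$, acting on functions of $(t,\xi)$, $t$-derivatives at fixed $\xi$, $\Delta_0^{(\xi)}$ the Laplace–Beltrami operator on $\mathbb S^{d-1}$. $\mathcal H_m^{d,0}$: homogeneous harmonic polynomials of degree $m$ on $\mathbb R^d$ (so $Y(t\xi)=t^mY(\xi)$), with basis $\{Y_\ell^m\}$. Jacobi polynomials for arbitrary real parameters: $P_j^{(\alpha,\beta)}(u)=\sum_{k=0}^j\frac{(\alpha+k+1)_{j-k}(-j)_k(j+\alpha+\beta+1)_k}{j!\,k!}(\frac{1-u}{2})^k$, $(a)_k$ the Pochhammer symbol. $P_j^{(2n-2j+d-2,-s)}(1-2t)\mathcal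 H_{n-j}^{d,0}$ denotes $\{P_j^{(2n-2j+d-2,-s)}(1-2t)Y(x):Y\in\mathcal H_{n-j}^{d,0}\}$. $\mathcal V_k^d(\mathsf w_{-1,s})$ is the span of $\{P_{k-m}^{(2m+d-2,s)}(1-2t)Y_\ell^m(x):0\le m\le k,\ \ell\}$, the orthogonal polynomials of degree $k$ on the cone for the weight $t^{-1}(1-t)^s$; all spaces are regarded as spaces of functions on the cone. *)

(* Defs.v *)
From HB Require Import structures.
From mathcomp Require Import all_boot all_order all_algebra.
From mathcomp Require Import all_classical all_reals all_analysis.
Set Implicit Arguments. Unset Strict Implicit. Unset Printing Implicit Defensive.
Import Order.TTheory GRing.Theory Num.Theory.
Import numFieldNormedType.Exports.
Local Open Scope ring_scope.

Section Defs.
Variable R : realType.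

Definition pochhammer (a : R) (k : nat) : R := \prod_(i < k) (a + i%:R).

Definition jacobiP (j : nat) (al be u : R) : R :=
  \sum_(k < j.+1)
    pochhammer (al + k%:R + 1) (j - k) * pochhammer (- j%:R) k
    * pochhammer (j%:R + al + be + 1) k / (j`!%:R * k`!%:R)
    * ((1 - u) / 2) ^+ k.

Definition enorm (d : nat) (x : 'rV[R]_d) : R := Num.sqrt (\sum_(i < d) x 0 i ^+ 2).

Definition evec (d : nat) (i : 'I_d) : 'rV[R]_d := delta_mx 0 i.

Definition laplacian (d : nat) (f : 'rV[R]_d -> R) (x : 'rV[R]_d) : R :=
  \sum_(i < d) derive1 (derive1 (fun h : R => f (x + h *: evec i))) 0.

(* Laplace--Beltrami operator on S^{d-1}: Laplacian of the 0-homogeneous extension *)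
Definition laplaceBeltrami (d : nat) (g : 'rV[R]_d -> R) (xi : 'rV[R]_d) : R :=
  laplacian (fun x => g ((enorm x)^-1 *: x)) xi.

Definition harmonic_homog (d m : nat) (Y : 'rV[R]_d -> R) : Prop :=
  (exists c : {ffun 'I_d -> 'I_m.+1} -> R,
     forall x, Y x = \sum_(a : {ffun 'I_d -> 'I_m.+1} | (\sum_(i < d) (a i : nat))%N == m)
                       c a * \prod_(i < d) x 0 i ^+ a i)
  /\ (forall x, laplacian Y x = 0).

Definition Dop (d : nat) (gam : R) (F : R -> 'rV[R]_d -> R) (t : R) (xi : 'rV[R]_d) : R :=
  t * (1 - t) * derive1 (derive1 (fun tau => F tau xi)) t
  + (d%:R - 1 - (d%:R + gam) * t) * derive1 (fun tau => F tau xi) t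
  + t^-1 * laplaceBeltrami (F t) xi.

(* Generic element of U_n^d(w_{-1,-s}):
   Y0 in H_n, Yj j in H_{n-j} (1 <= j <= min(s-1,n)), W m in H_m (0 <= m <= n-s),
   the last part being (1-t)^s times a generic element of V_{n-s}^d(w_{-1,s}). *)
Definition Uelem (d n s : nat) (Y0 : 'rV[R]_d -> R) (Yj W : nat -> 'rV[R]_d -> R)
  (t : R) (xi : 'rV[R]_d) : R :=
  Y0 (t *: xi)
  + \sum_(1 <= j < (minn (s - 1) n).+1)
      jacobiP j (2 * n%:R - 2 * j%:R + d%:R - 2) (- s%:R) (1 - 2 * t) * Yj j (t *: xi)
  + (if (s <= n)%N then
       (1 - t) ^+ s * \sum_(0 <= m < (n - s).+1)
          jacobiP (n - s - m) (2 * m%:R + d%:R - 2) s%:R (1 - 2 * t) * W m (t *: xi)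
     else 0).

End Defs.

(* Main.v *)
Require Import Defs.
From HB Require Import structures.
From mathcomp Require Import all_boot all_order all_algebra.
From mathcomp Require Import all_classical all_reals all_analysis.
From mathcomp Require Import ring.
Import Order.TTheory GRing.Theory Num.Theory.
Import numFieldNormedType.Exports.
Set Implicit Arguments. Unset Strict Implicit. Unset Printing Implicit Defensive.
Local Open Scope ring_scope.

(**
Every component of the span has the form [p(t) Y(t xi)] with [Y] harmonic and
homogeneous of degree [m].  Since [Y(t xi) = t^m Y(xi)] and the spherical
Laplacian of [Y] is [- m (m + d - 2) Y] (Euler's identity applied to
[|x|^(-m) Y(x)]), the cone operator reduces to an ordinary differential operator
on [t^m p(t)]; the terms in [1/t] cancel, and what remains is Jacobi's equation
for [p] with parameters [(2m + d - 2, - s)].  It is solved by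
[P_j^(2m+d-2,-s)(1 - 2t)], where [m + j = n], and, by conjugation with the
weight, by [(1 - t)^s P_k^(2m+d-2,s)(1 - 2t)], where [m + k + s = n]; in all cases
the eigenvalue depends only on [n].
*)

(** Lets a known equation [c = e], often a linear combination of hypotheses, prove [a = b], leaving
    an identity for [ring]. *)
Lemma eq_from_subr (V : zmodType) (a b c e : V) : c = e -> a - b = c - e -> a = b.
Proof. by move=> -> /eqP; rewrite subrr subr_eq0 => /eqP. Qed.

(** * Jacobi's differential equation in the variable t *)

Section JacobiEquation.
Variable R : realType.
Implicit Types (al be lam t : R) (p : {poly R}).

Definition jacobi_coef j al be k : R :=
  pochhammer (al + k%:R + 1) (j - k) * pochhammer (- j%:R) k
  * pochhammer (j%:R + al + be + 1) k / (j`!%:R * k`!%:R).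

Definition jacobi_poly j al be : {poly R} :=
  \poly_(k < j.+1) jacobi_coef j al be k.

Lemma jacobi_polyE j al be t :
  jacobiP j al be (1 - 2 * t) = (jacobi_poly j al be).[t].
Proof.
rewrite horner_poly; apply: eq_bigr => k _; congr (_ * _ ^+ _).
by field.
Qed.

Lemma pochhammerSl (a : R) k :
  pochhammer a k.+1 = a * pochhammer (a + 1) k.
Proof.
rewrite /pochhammer big_ord_recl addr0; congr (_ * _).
by apply: eq_bigr => i _; rewrite /bump /= natrD addrA.
Qed.

Lemma pochhammerSr (a : R) k :
  pochhammer a k.+1 = pochhammer a k * (a + k%:R).
Proof. by rewrite /pochhammer big_ord_recr. Qed.

(** Raising k appends a factor to the last two Pochhammer symbols and strips the leading factor al +
    k + 1 from the first. That factor may vanish for real parameters, so nothing is divided by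
    it. *)
Lemma jacobi_coefS j al be k : (k < j)%N ->
  k.+1%:R * (k%:R + al + 1) * jacobi_coef j al be k.+1
  = (k%:R - j%:R) * (j%:R + al + be + 1 + k%:R) * jacobi_coef j al be k.
Proof.
move=> kj; rewrite /jacobi_coef !pochhammerSr.
have -> : (j - k = (j - k.+1).+1)%N by rewrite subnSK.
rewrite pochhammerSl factS natrM.
have -> : al + k%:R + 1 + 1 = al + k.+1%:R + 1 by rewrite -natr1; ring.
field.
rewrite !pnatr_eq0 -!lt0n !fact_gt0 /=.
by rewrite addrC natr1 pnatr_eq0.
Qed.

(* Jacobi's equation in the variable t, where P_j^(al,be) is taken at 1 - 2t. *)
Definition jacobi_ode al be lam p := forall t,
  t * (1 - t) * p^`()^`().[t] + (al + 1 - (al + be + 2) * t) * p^`().[t]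
  = - lam * p.[t].

(** The operator sends t^k to a combination of t^k and t^(k-1), so comparing coefficients gives a
    two-term recurrence. *)
Lemma jacobi_ode_coef al be lam p :
  (forall k, k.+1%:R * (k%:R + al + 1) * p`_k.+1
     = (k%:R * (k%:R + al + be + 1) - lam) * p`_k) ->
  jacobi_ode al be lam p.
Proof.
move=> pP t.
have pE : 'X * p^`()^`() - 'X * ('X * p^`()^`()) + (al + 1) *: p^`()
     - (al + be + 2) *: ('X * p^`()) = - lam *: p.
  apply/polyP => k; rewrite !(coefD, coefN, coefZ, coefXM, coef_deriv).
  have := pP k; case: k => [|[|k]] /= Ek; apply: (eq_from_subr Ek).
  - by move: p`_0 p`_1 => a b; ring.
  - by move: p`_1 p`_2 => a b; ring.
  by move: p`_k.+2 p`_k.+3 => a b; ring.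
have /(congr1 (horner^~ t)) := pE.
rewrite !(hornerD, hornerN, hornerM, hornerX, hornerZ) => <-.
by move: (p^`().[t]) (p^`()^`().[t]) => a b; ring.
Qed.

(** With c = al + be + 1, k(k + c) - j(j + c) = (k - j)(k + j + c), so [jacobi_coefS] settles k < j.
    At k = j the factor k - j vanishes; for k > j both coefficients do. *)
Lemma jacobi_poly_ode j al be :
  jacobi_ode al be (j%:R * (j%:R + al + be + 1)) (jacobi_poly j al be).
Proof.
apply: jacobi_ode_coef => k; rewrite !coef_poly ltnS.
case: (ltngtP k j) => kj.
- rewrite ltnS (ltnW kj) jacobi_coefS //.
  by move: (jacobi_coef _ _ _ _) => c; ring.
- by rewrite ltnNge kj /= !mulr0.
- by rewrite kj ltnSn mulr0 subrr mul0r.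
Qed.

(** Conjugation by (1 - t)^s changes the parameter s into -s and shifts the eigenvalue by s(al +
    1). *)
Lemma jacobi_ode_weight k al s p :
  jacobi_ode al s%:R (k%:R * (k%:R + al + s%:R + 1)) p ->
  jacobi_ode al (- s%:R) ((k + s)%:R * ((k + s)%:R + al - s%:R + 1))
    ((1 - 'X) ^+ s * p).
Proof.
move=> pP t; set w := (1 - 'X) ^+ s.
(* The factor 1 - X keeps the exponent s - 1 out of the formula. *)
have dw : (1 - 'X) * w^`() = - s%:R *: w.
  rewrite /w deriv_exp derivB derivX -polyC1 derivC sub0r scaleNr.
  case: s {pP w} => [|s]; first by rewrite !mulr0n scale0r mulr0 oppr0.
  by rewrite scaler_nat exprS /= polyC1; move: (1 - _) => u; ring.
have ddw : (1 - 'X) * w^`()^`() = (1 - s%:R) *: w^`().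
  have := congr1 (@deriv R) dw.
  rewrite derivM derivZ derivB derivX -(polyC1) derivC sub0r => E.
  by apply: (eq_from_subr E); rewrite scalerBl scale1r scaleNr; ring.
have /(congr1 (horner^~ t)) := dw; have /(congr1 (horner^~ t)) := ddw.
rewrite !(derivM, derivD, hornerD, hornerN, hornerM, hornerX, hornerZ, hornerC).
move: w.[t] w^`().[t] w^`()^`().[t] (pP t) => w0 w1 w2.
move: p.[t] p^`().[t] p^`()^`().[t] => p0 p1 p2 E E2 E1.
(* The multiplier of [E2] eliminates w''; what then remains in w' is (1 - t)(2t p' + (al + 1)p),
   whence the multiplier of [E1]. *)
apply: (eq_from_subr (congr2 +%R (congr1 ( *%R w0) E) (congr2 +%R
  (congr1 ( *%R (t * p0)) E2)
  (congr1 ( *%R (2 * t * p1 + (al + 1) * p0)) E1)))).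
by rewrite natrD; ring.
Qed.

End JacobiEquation.

(** * Calculus of first and second derivatives at a point *)

Section SecondDerivative.
Variable R : realType.
Implicit Types (f g : R -> R) (x a b : R).

(** The first derivative must exist near [x], so that [derive1 f] is known on a neighbourhood and
    can be differentiated again. *)
Definition has_deriv2 f x a b := exists2 f1 : R -> R,
  (\forall y \near x, is_derive y (1 : R) f (f1 y)) & f1 x = a /\ is_derive x (1 : R) f1 b.

Lemma has_deriv2_derive1 f x a b : has_deriv2 f x a b ->
  derive1 f x = a /\ derive1 (derive1 f) x = b.
Proof.
move=> [f1 f1P [f1x f1d]]; split.
  by rewrite derive1E -f1x; have := nbhs_singleton f1P => -[].
rewrite derive1E; transitivity ('D_1 f1 x); last by case: f1d.
apply: near_eq_derive.
by near=> y; rewrite derive1E; have [] := near f1P y.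
Unshelve. all: by end_near. Qed.

Lemma has_deriv2_eq f x a b a' b' :
  has_deriv2 f x a b -> a = a' -> b = b' -> has_deriv2 f x a' b'.
Proof. by move=> fab <- <-. Qed.

Lemma has_deriv2_cst c x : has_deriv2 (fun=> c) x 0 0.
Proof.
exists (fun=> 0); first by near=> y; exact: is_derive_cst.
by split=> //; exact: is_derive_cst.
Unshelve. all: by end_near. Qed.

Lemma has_deriv2D f g x a b a' b' :
  has_deriv2 f x a b -> has_deriv2 g x a' b' ->
  has_deriv2 (fun y => f y + g y) x (a + a') (b + b').
Proof.
move=> [f1 f1P [<- f1d]] [g1 g1P [<- g1d]].
exists (fun y => f1 y + g1 y); last by split=> //; exact: is_deriveD.
near=> y; have fy := near f1P y; have gy := near g1P y.
exact: is_deriveD (fy _) (gy _).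
Unshelve. all: by end_near. Qed.

Lemma has_deriv2M f g x a b a' b' :
  has_deriv2 f x a b -> has_deriv2 g x a' b' ->
  has_deriv2 (fun y => f y * g y) x
    (f x * a' + g x * a) (f x * b' + 2 * a * a' + g x * b).
Proof.
move=> [f1 f1P [<- f1d]] [g1 g1P [<- g1d]].
exists (fun y => f y * g1 y + g y * f1 y).
  near=> y; have fy := near f1P y; have gy := near g1P y.
  exact: is_deriveM (fy _) (gy _).
split=> //; have fx := nbhs_singleton f1P; have gx := nbhs_singleton g1P.
apply: (@is_derive_eq _ _ _ _ _ _ _ _
  (is_deriveD (is_deriveM fx g1d) (is_deriveM gx f1d))).
by rewrite /GRing.scale /=; ring.
Unshelve. all: by end_near. Qed.

Lemma has_deriv2_horner (p : {poly R}) x :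
  has_deriv2 (fun y => p.[y]) x p^`().[x] p^`()^`().[x].
Proof.
exists (fun y => p^`().[y]); first by near=> y; exact: is_derive_poly.
by split=> //; exact: is_derive_poly.
Unshelve. all: by end_near. Qed.

(** In powers of the inverse root, the result can be differentiated again by the same rule, with m +
    2 for m. *)
Lemma is_derive_invsqrtX (q : {poly R}) m y : 0 < q.[y] ->
  is_derive y (1 : R) (fun h => (Num.sqrt q.[h])^-1 ^+ m)
    (- m%:R * (q^`().[y] / 2) * (Num.sqrt q.[y])^-1 ^+ m.+2).
Proof.
move=> qy; have sy : Num.sqrt q.[y] != 0 by rewrite sqrtr_eq0 -ltNge.
have dsq : is_derive y (1 : R) (fun h => Num.sqrt q.[h])
    ((2 * Num.sqrt q.[y])^-1 * q^`().[y]).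
  exact: (@is_derive1_comp _ Num.sqrt (horner q) y _ _ (is_derive1_sqrt qy)).
have := is_deriveX m (@is_deriveV R (fun h => Num.sqrt q.[h]) y _ _ sy dsq).
rewrite exprfctE => dX; refine (is_derive_eq dX _).
rewrite /GRing.scale /=.
case: m {dX} => [|m]; first by rewrite !mul0r oppr0 !mul0r.
rewrite /= !exprS; move: ((Num.sqrt _)^-1 ^+ m) => z.
by field.
Qed.

(** [is_derive_invsqrtX] is used with m, then m + 2; [q] stays positive near [x] by continuity. *)
Lemma has_deriv2_invsqrtX (q : {poly R}) m x :
  q.[x] = 1 ->
  has_deriv2 (fun h => (Num.sqrt q.[h])^-1 ^+ m) x
    (- m%:R * (q^`().[x] / 2))
    (- m%:R * (q^`()^`().[x] / 2) + m%:R * m.+2%:R * (q^`().[x] / 2) ^+ 2).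
Proof.
move=> qx.
exists (fun y => (- m%:R / 2 *: q^`()).[y] * (Num.sqrt q.[y])^-1 ^+ m.+2).
  have : \forall y \near x, 0 < q.[y].
    have qc : {for x, continuous (horner q)}.
      apply: differentiable_continuous; apply/derivable1_diffP.
      exact: derivable_horner.
    by apply: (cvgr_gt _ qc); rewrite qx.
  move=> q0; near=> y; have qy : 0 < q.[y] by exact: (near q0 y).
  refine (is_derive_eq (is_derive_invsqrtX m qy) _).
  by rewrite hornerZ; ring.
have q0 : 0 < q.[x] by rewrite qx.
split; first by rewrite hornerZ qx sqrtr1 invr1 expr1n; ring.
refine (is_derive_eq (is_deriveM (is_derive_poly _ _)
  (is_derive_invsqrtX m.+2 q0)) _).
rewrite /GRing.scale /= derivZ !hornerZ qx sqrtr1 invr1 !expr1n.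
by field.
Unshelve. all: by end_near. Qed.

End SecondDerivative.

Lemma mulX_derivXn (K : nzRingType) m : 'X * ('X^m)^`() = m%:R *: 'X^m :> {poly K}.
Proof.
rewrite derivXn scaler_nat; case: m => [|m]; first by rewrite !mulr0n mulr0.
by rewrite mulrnAr -exprS.
Qed.

(** * Harmonic polynomials on coordinate lines and separation of variables on the cone *)

Section ConeOperator.
Variables (R : realType) (d : nat).
Implicit Types (F G : R -> 'rV[R]_d -> R) (Y : 'rV[R]_d -> R) (xi : 'rV[R]_d).

Lemma sum_sqr_enorm1 xi : enorm xi = 1 -> \sum_i xi 0 i ^+ 2 = 1.
Proof.
move=> xi1; rewrite -[RHS](expr1n _ 2) -xi1 sqr_sqrtr //.
by apply: sumr_ge0 => j _; exact: sqr_ge0.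
Qed.

Lemma enorm_line xi (i : 'I_d) h : enorm xi = 1 ->
  enorm (xi + h *: evec R i) = Num.sqrt ('X^2 + (2 * xi 0 i) *: 'X + 1).[h].
Proof.
move=> xi1; rewrite /enorm; congr Num.sqrt.
rewrite !(hornerD, hornerZ, hornerXn, hornerX, hornerC).
move: (sum_sqr_enorm1 xi1).
rewrite (bigD1 i) //= [in X in _ -> X](bigD1 i) //= !mxE !eqxx mulr1 => xi2.
rewrite (eq_bigr (fun j => xi 0 j ^+ 2)) => [|j /negbTE ji].
  by apply: (eq_from_subr xi2); ring.
by rewrite !mxE ji andbF mulr0 addr0.
Qed.

(** The restriction of x^a to the line xi + h e_i, as a polynomial in h. *)
Definition monomial_line xi (a : {ffun 'I_d -> nat}) (i : 'I_d) : {poly R} :=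
  \prod_(j < d) ((xi 0 j)%:P + (j == i)%:R *: 'X) ^+ a j.

Lemma monomial_lineE xi a i h :
  (monomial_line xi a i).[h] = \prod_(j < d) (xi + h *: evec R i) 0 j ^+ a j.
Proof.
rewrite /monomial_line horner_prod; apply: eq_bigr => j _.
by rewrite horner_exp hornerD hornerC hornerZ hornerX !mxE eqxx mulrC.
Qed.

(** One coordinate of Euler's identity: the factor xi_i restores the exponent lowered by
    differentiation. *)
Lemma deriv_monomial_line xi a i :
  xi 0 i * (monomial_line xi a i)^`().[0]
  = (a i)%:R * \prod_(j < d) xi 0 j ^+ a j.
Proof.
rewrite /monomial_line (bigD1 i) //= eqxx scale1r.
set P := \prod_(j < d | j != i) _.
have PC : P = (\prod_(j < d | j != i) xi 0 j ^+ a j)%:P.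
  rewrite /P rmorph_prod; apply: eq_bigr => j /negbTE ->.
  by rewrite scale0r addr0 rmorphXn.
rewrite PC derivM derivC mulr0 addr0 deriv_exp derivD derivC derivX add0r mul1r.
rewrite hornerM hornerC hornerMn horner_exp hornerD hornerC hornerX addr0.
rewrite [in RHS](bigD1 i) //=; move: (\prod_(j < d | _) _) => c.
case: (a i) => [|k]; first by rewrite mulr0n !mul0r mulr0.
by rewrite /= exprS; ring.
Qed.

Lemma homog_scale m Y c xi : harmonic_homog m Y ->
  Y (c *: xi) = c ^+ m * Y xi.
Proof.
move=> [[f fP] _]; rewrite !fP mulr_sumr; apply: eq_bigr => a /eqP am.
rewrite mulrCA; congr (_ * _).
rewrite -[X in c ^+ X]am -prodrXr -big_split; apply: eq_bigr => j _ /=.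
by rewrite mxE exprMn.
Qed.

(** Euler's identity follows monomial by monomial because the exponents sum to m; polynomial
    restrictions make the later derivatives formal. *)
Lemma harmonic_homog_line m Y xi : harmonic_homog m Y ->
  exists P : 'I_d -> {poly R},
  [/\ forall i h, Y (xi + h *: evec R i) = (P i).[h],
      \sum_i xi 0 i * (P i)^`().[0] = m%:R * Y xi
    & \sum_i (P i)^`()^`().[0] = 0].
Proof.
move=> [[c cP] Yharm].
pose na (a : {ffun 'I_d -> 'I_m.+1}) : {ffun 'I_d -> nat} := [ffun i => a i : nat].
pose P i : {poly R} :=
  \sum_(a : {ffun 'I_d -> 'I_m.+1} | (\sum_(i < d) (a i : nat))%N == m)
     c a *: monomial_line xi (na a) i.
have PE i h : Y (xi + h *: evec R i) = (P i).[h].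
  rewrite cP horner_sum; apply: eq_bigr => a _.
  rewrite hornerZ monomial_lineE; congr (_ * _).
  by apply: eq_bigr => j _; rewrite ffunE.
exists P; split=> //.
- under eq_bigr do rewrite /P raddf_sum horner_sum mulr_sumr.
  rewrite exchange_big cP mulr_sumr /=; apply: eq_bigr => a /eqP am.
  under eq_bigr do rewrite derivZ hornerZ mulrCA deriv_monomial_line ffunE.
  rewrite -mulr_sumr -mulr_suml -natr_sum am mulrCA; congr (_ * (_ * _)).
  by apply: eq_bigr => j _; rewrite ffunE.
- rewrite -[RHS](Yharm xi); apply: eq_bigr => i _.
  have -> : (fun h : R => Y (xi + h *: evec R i)) = (fun h => (P i).[h]).
    by apply/funext => h; exact: PE.
  by have [_ ->] := has_deriv2_derive1 (has_deriv2_horner (P i) 0).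
Qed.

(* Records the existence of the derivatives in [Dop], which makes the eigenvalue
   equation stable under sums. *)
Definition cone_eigen (gam lam t : R) xi F := exists a1 a2 (b1 b2 : 'I_d -> R),
  [/\ has_deriv2 (fun tau => F tau xi) t a1 a2,
      forall i, has_deriv2 (fun h => F t ((enorm (xi + h *: evec R i))^-1 *:
                                      (xi + h *: evec R i))) 0 (b1 i) (b2 i)
    & t * (1 - t) * a2 + (d%:R - 1 - (d%:R + gam) * t) * a1
      + t^-1 * \sum_i b2 i = lam * F t xi].

Lemma cone_eigen_Dop gam lam t xi F : cone_eigen gam lam t xi F ->
  Dop gam F t xi = lam * F t xi.
Proof.
move=> [a1 [a2 [b1 [b2 [/has_deriv2_derive1[Fa1 Fa2] Fb <-]]]]].
rewrite /Dop Fa1 Fa2; congr (_ + _ * _); apply: eq_bigr => i _.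
by have [_] := has_deriv2_derive1 (Fb i).
Qed.

Lemma cone_eigen0 gam lam t xi : cone_eigen gam lam t xi (fun _ _ => 0).
Proof.
exists 0, 0, (fun=> 0), (fun=> 0); split; [exact: has_deriv2_cst | |].
  by move=> i; exact: has_deriv2_cst.
by rewrite big1 // !mulr0 !addr0.
Qed.

Lemma cone_eigenD gam lam t xi F G :
  cone_eigen gam lam t xi F -> cone_eigen gam lam t xi G ->
  cone_eigen gam lam t xi (fun tau x => F tau x + G tau x).
Proof.
move=> [a1 [a2 [b1 [b2 [Fa Fb FE]]]]] [c1 [c2 [e1 [e2 [Ga Gb GE]]]]].
exists (a1 + c1), (a2 + c2), (fun i => b1 i + e1 i), (fun i => b2 i + e2 i).
split; [exact: has_deriv2D | by move=> i; exact: has_deriv2D |].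
by rewrite /= [RHS]mulrDr -FE -GE big_split /=; ring.
Qed.

Lemma cone_eigen_sum gam lam t xi (r : seq nat) (F : nat -> R -> 'rV[R]_d -> R) :
  (forall i, i \in r -> cone_eigen gam lam t xi (F i)) ->
  cone_eigen gam lam t xi (fun tau x => \sum_(i <- r) F i tau x).
Proof.
elim: r => [|i r IHr] Fr.
  under eq_fun2 do rewrite big_nil.
  exact: cone_eigen0.
under eq_fun2 do rewrite big_cons.
apply: cone_eigenD; first by apply: Fr; rewrite mem_head.
by apply: IHr => j jr; apply: Fr; rewrite in_cons jr orbT.
Qed.

(** For t^m p, the terms with one derivative of p have coefficient 2m + d - 1 - (2m + d - s)t, which
    fixes the Jacobi parameters; the part of the undifferentiated term free of 1/t contributes -m(m
    - 1 + d - s). *)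
Lemma cone_eigen_mode m Y (p : {poly R}) (s lam t : R) xi :
  harmonic_homog m Y -> 0 < t -> enorm xi = 1 ->
  jacobi_ode (2 * m%:R + d%:R - 2) (- s) lam p ->
  cone_eigen (- s) (- (lam + m%:R * (m%:R - 1 + d%:R - s))) t xi
    (fun tau x => p.[tau] * Y (tau *: x)).
Proof.
move=> Ym t0 xi1 pode; have tn0 : t != 0 by rewrite gt_eqF.
have [P [PE PEuler Pharm]] := harmonic_homog_line xi Ym.
(* [q i] is the squared norm along xi + h e_i. *)
pose q i : {poly R} := 'X^2 + (2 * xi 0 i) *: 'X + 1.
have q0 i : (q i).[0] = 1.
  by rewrite /q !(hornerD, hornerZ, hornerXn, hornerX, hornerC); ring.
have q1 i : (q i)^`().[0] / 2 = xi 0 i.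
  rewrite /q !(derivD, derivZ, derivX, derivXn) -polyC1 derivC.
  by rewrite !(hornerD, hornerZ, hornerMn, hornerXn, hornerC) /= expr1; field.
have q2 i : (q i)^`()^`().[0] / 2 = 1.
  rewrite /q !(derivD, derivZ, derivX, derivXn, derivMn) -polyC1 !derivC.
  by rewrite !(hornerD, hornerZ, hornerMn, hornerXn, hornerC) /= expr0; field.
have P0 i : (P i).[0] = Y xi by rewrite -PE scale0r addr0.
set K := p.[t] * t ^+ m.
exists ((p * 'X^m)^`().[t] * Y xi), ((p * 'X^m)^`()^`().[t] * Y xi).
(* These witnesses are the derivatives at h = 0 of K q^(-m/2) P, where q = 1, q'/2 = xi_i and q''/2
   = 1. *)
exists (fun i => K * ((P i)^`().[0] - m%:R * xi 0 i * Y xi)).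
exists (fun i => K * ((P i)^`()^`().[0] - 2 * m%:R * (xi 0 i * (P i)^`().[0])
   + (m%:R * m.+2%:R * xi 0 i ^+ 2 - m%:R) * Y xi)); split.
- have -> : (fun tau => p.[tau] * Y (tau *: xi)) =
      (fun tau => (p * 'X^m).[tau] * Y xi).
    by apply/funext => tau; rewrite (homog_scale _ _ Ym) hornerM hornerXn mulrA.
  apply: (has_deriv2_eq (has_deriv2M (has_deriv2_horner (p * 'X^m) t)
    (has_deriv2_cst (Y xi) t))); ring.
- move=> i.
  have -> : (fun h => p.[t] * Y (t *: ((enorm (xi + h *: evec R i))^-1 *:
                                      (xi + h *: evec R i)))) =
      (fun h => K * ((Num.sqrt (q i).[h])^-1 ^+ m * (P i).[h])).
    apply/funext => h; rewrite !(homog_scale _ _ Ym) PE enorm_line // -/(q i).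
    by rewrite !mulrA.
  apply: (has_deriv2_eq (has_deriv2M (has_deriv2_cst K 0)
    (has_deriv2M (has_deriv2_invsqrtX m (q0 i)) (has_deriv2_horner (P i) 0))));
    rewrite q0 sqrtr1 invr1 expr1n P0 q1 ?q2; ring.
(* Summing over i gives -2m^2 + m(m + 2) - md = -m(m + d - 2) times K Y(xi). *)
rewrite -mulr_sumr !big_split /= sumrN -mulr_sumr -mulr_suml PEuler Pharm.
rewrite big_split /= sumrN -mulr_sumr (sum_sqr_enorm1 xi1) sumr_const card_ord -mulr_natr.
rewrite (homog_scale _ _ Ym).
(* X(X^m)' = m X^m and its derivative give both derivatives of t^m after division by t, without the
   exponents m - 1 and m - 2. *)
have := congr1 (fun u : {poly R} => u^`().[t]) (mulX_derivXn R m).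
have := congr1 (horner^~ t) (mulX_derivXn R m).
rewrite /K !(derivM, derivX, derivZ, derivD).
rewrite !(hornerD, hornerM, hornerZ, hornerX, hornerXn, hornerC).
move: (pode t) => {pode K}.
move: p.[t] p^`().[t] p^`()^`().[t] => p0 p1 p2.
move: ('X^m)^`().[t] ('X^m)^`()^`().[t] (t ^+ m) (Y xi) => w1 w2 w0 y E E1 E2.
have w1E : w1 = m%:R * w0 / t by rewrite -E1 mulrC mulKf.
have w2E : w2 = (m%:R - 1) * w1 / t.
  by rewrite mulrBl mul1r -E2 mul1r addrAC subrr add0r mulrC mulKf.
apply: (eq_from_subr (congr1 ( *%R (w0 * y)) E)); rewrite {}w2E {}w1E.
by field.
Qed.

End ConeOperator.

(** * The three families spanning the space, with their common eigenvalue *)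

Section EigenComponents.
Variables (R : realType) (d s n : nat) (t : R) (xi : 'rV[R]_d).
Hypotheses (t0 : 0 < t) (xi1 : enorm xi = 1).

Let eigen_n := cone_eigen (- s%:R) (- (n%:R * (n%:R - s%:R + d%:R - 1))) t xi.

(** The radial factor 1 solves Jacobi's equation with eigenvalue 0. *)
Lemma cone_eigen_harmonic (Y : 'rV[R]_d -> R) : harmonic_homog n Y ->
  eigen_n (fun tau x => Y (tau *: x)).
Proof.
move=> Yn; have ode1 : jacobi_ode (2 * n%:R + d%:R - 2) (- s%:R) 0 (1 : {poly R}).
  by move=> u; rewrite -polyC1 !derivC !hornerC; ring.
have := cone_eigen_mode Yn t0 xi1 ode1.
congr cone_eigen; first by ring.
by apply/funext => tau; apply/funext => x; rewrite hornerC mul1r.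
Qed.

(** With m = n - j, the Jacobi eigenvalue j(j + al - s + 1) and m(m - 1 + d - s) add up to n(n - s +
    d - 1). *)
Lemma cone_eigen_jacobi (Y : 'rV[R]_d -> R) j : (j <= n)%N ->
  harmonic_homog (n - j) Y ->
  eigen_n (fun tau x => jacobiP j (2 * n%:R - 2 * j%:R + d%:R - 2) (- s%:R)
                          (1 - 2 * tau) * Y (tau *: x)).
Proof.
move=> jn Yn; set al : R := 2 * n%:R - _ + _ - _.
have alE : 2 * (n - j)%:R + d%:R - 2 = al by rewrite natrB // /al; ring.
have := jacobi_poly_ode j al (- s%:R); rewrite -{1}alE => /(cone_eigen_mode Yn t0 xi1).
congr cone_eigen; first by rewrite natrB // /al; ring.
by apply/funext => tau; apply/funext => x; rewrite jacobi_polyE.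
Qed.

(** After conjugation the degree n - s - m becomes n - m, so the eigenvalue computation is that of
    [cone_eigen_jacobi] with j = n - m. *)
Lemma cone_eigen_weighted (Y : 'rV[R]_d -> R) m : (s <= n)%N ->
  (m <= n - s)%N -> harmonic_homog m Y ->
  eigen_n (fun tau x => (1 - tau) ^+ s *
    (jacobiP (n - s - m) (2 * m%:R + d%:R - 2) s%:R (1 - 2 * tau) * Y (tau *: x))).
Proof.
move=> sn mns Ym; set al : R := 2 * m%:R + d%:R - 2.
have := cone_eigen_mode Ym t0 xi1
  (jacobi_ode_weight (jacobi_poly_ode (n - s - m) al s%:R)).
congr cone_eigen; first by rewrite natrD !natrB // /al; ring.
apply/funext => tau; apply/funext => x.
by rewrite jacobi_polyE hornerM horner_exp hornerD hornerN hornerX hornerC mulrA.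
Qed.

End EigenComponents.

Theorem mainTheorem10 (R : realType) (d s n : nat) (hd : (2 <= d)%N) (hs : (2 <= s)%N)
  (Y0 : 'rV[R]_d -> R) (Yj W : nat -> 'rV[R]_d -> R)
  (hY0 : harmonic_homog n Y0)
  (hYj : forall j : nat, (1 <= j)%N -> (j <= minn (s - 1) n)%N -> harmonic_homog (n - j) (Yj j))
  (hW : (s <= n)%N -> forall m : nat, (m <= n - s)%N -> harmonic_homog m (W m)) :
  forall (t : R) (xi : 'rV[R]_d), 0 < t <= 1 -> enorm xi = 1 ->
    Dop (- s%:R) (Uelem n s Y0 Yj W) t xi
    = - (n%:R * (n%:R - s%:R + d%:R - 1)) * Uelem n s Y0 Yj W t xi.
Proof.
move=> t xi /andP[t0 _] xi1; apply: cone_eigen_Dop; rewrite /Uelem.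
apply: cone_eigenD; first (apply: cone_eigenD).
- exact: cone_eigen_harmonic.
- apply: cone_eigen_sum => j; rewrite mem_index_iota ltnS => /andP[j1 js].
  apply: cone_eigen_jacobi => //; last exact: hYj.
  by rewrite (leq_trans js) ?geq_minr.
case: leqP => [sn|_]; last exact: cone_eigen0.
(* The weight is moved inside the sum so that each summand is a single mode. *)
under eq_fun2 do rewrite mulr_sumr.
apply: cone_eigen_sum => m; rewrite mem_index_iota ltnS => /= mns.
by apply: cone_eigen_weighted => //; exact: hW.
Qed.
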